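(* For every formula $\varphi$ of the language $\Phi$, $\varphi$ is derivable in the axiomatic system $\mathsf{MCL}$ if and only if $\varphi$ is $\mathsf{MCL}$-valid (i.e. true at every state of every general concurrent game model).
   Context: Fix a nonempty finite set $AG$ of agents and a countable set $AP$ of atomic propositions; a coalition is any subset $A\subseteq AG$. The language $\Phi$ is given by $\varphi ::= \top \mid p \mid \neg\varphi \mid (\varphi\wedge\varphi) \mid \langle A\rangle\varphi$ with $p\in AP$, $A\subseteq AG$; $\bot,\vee,\to,\leftrightarrow$ are defined as usual. Given a nonempty set $AC$ of actions, a joint action of $A$ is a function $\sigma_A:A\to AC$; $JA_A$ is the set of joint actions of $A$ (so $JA_\emptyset=\{\emptyset\}$). Joint actions are sets of pairs, so inclusion $\sigma_A\subseteq\sigma_B$ makes sense. For $B\subseteq A$, $\sigma_A|_B$ is the restriction, and for a set $\Sigma$ of joint actions of $A$, $\Sigma|_B=\{\sigma|_B:\sigma\in\Sigma\}$. An abstract multi-agent action model is $M=(ST,AC,\{av_A\}_{A\subseteq AG},\{out_A\}_{A\subseteq AG},lab)$ with $ST$ a nonempty set of states, $AC$ a nonempty set of actions, $av_A:ST\to\mathcal P(JA_A)$, $out_A:ST\times JA_A\to\mathcal P(ST)$, $lab:ST\to\mathcal P(AP)$. Truth: $M,s\Vdash\top$ always; $M,s\Vdash p$ iff $p\in lab(s)$; Boolean clauses as usual; $M,s\Vdash\langle A\rangle\varphi$ iff there is $\sigma_A\in av_A(s)$ such that $M,t\Vdash\varphi$ for all $t\in out_A(s,\sigma_A)$. A general concurrent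 game model is such an $M$ satisfying, for all $A\subseteq AG$, $s\in ST$, $\sigma_A\in JA_A$: (i) $av_A(s)=av_{AG}(s)|_A$; (ii) $av_{AG}(s)=\{\sigma\in JA_{AG}: out_{AG}(s,\sigma)\neq\emptyset\}$; (iii) $out_A(s,\sigma_A)=\bigcup\{out_{AG}(s,\sigma_{AG}):\sigma_{AG}\in JA_{AG},\ \sigma_A\subseteq\sigma_{AG}\}$. The axiomatic system $\mathsf{MCL}$ has axioms: all propositional tautologies; $\langle\emptyset\rangle(\varphi\to\psi)\to(\langle A\rangle\varphi\to\langle A\rangle\psi)$; $\langle A\rangle\varphi\to\langle B\rangle\varphi$ whenever $A\subseteq B$; $\neg\langle A\rangle\bot$; and rules: modus ponens, and from $\varphi$ infer $\langle A\rangle\psi\to\langle\emptyset\rangle\varphi$ (for any $A$, $\psi$). *)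

(* Defs.v *)
From HB Require Import structures.
From mathcomp Require Import all_boot.
From mathcomp Require Import boolp classical_sets.

Set Implicit Arguments.
Unset Strict Implicit.
Unset Printing Implicit Defensive.

Section Syntax.

Variables (AG : finType) (AP : Type).

Inductive formula : Type :=
  | Top
  | Atom of AP
  | Neg of formula
  | And of formula & formula
  | Coal of {set AG} & formula.

Definition Bot : formula := Neg Top.
Definition Or (f g : formula) : formula := Neg (And (Neg f) (Neg g)).
Definition Imp (f g : formula) : formula := Or (Neg f) g.
Definition Iff (f g : formula) : formula := And (Imp f g) (Imp g f).

(* Propositional evaluation: atoms and formulas [Coal A f] are both treated as
   propositional variables, valued by [v]. *)
Fixpoint prop_eval (v : formula -> bool) (f : formula) : bool :=
  match f with
  | Top => true
  | Atom _ => v f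
  | Neg g => ~~ prop_eval v g
  | And g h => prop_eval v g && prop_eval v h
  | Coal _ _ => v f
  end.

(* That is, [f] is a substitution instance of a classical tautology. *)
Definition tautology (f : formula) : Prop := forall v, prop_eval v f.

Inductive MCL_derivable : formula -> Prop :=
  | MCL_taut f : tautology f -> MCL_derivable f
  | MCL_K A f g :
      MCL_derivable
        (Imp (Coal finset.set0 (Imp f g)) (Imp (Coal A f) (Coal A g)))
  | MCL_mono (A B : {set AG}) f :
      A \subset B -> MCL_derivable (Imp (Coal A f) (Coal B f))
  | MCL_noBot A : MCL_derivable (Neg (Coal A Bot))
  | MCL_mp f g :
      MCL_derivable f -> MCL_derivable (Imp f g) -> MCL_derivable g
  | MCL_nec A f g :
      MCL_derivable f -> MCL_derivable (Imp (Coal A g) (Coal finset.set0 f)).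

End Syntax.

Arguments Top {AG AP}.
Arguments Atom {AG AP} _.
Arguments Bot {AG AP}.

Section JointActions.

Variables (AG : finType) (AC : Type).

Definition joint_action (A : {set AG}) : Type :=
  {ffun {a : AG | a \in A} -> AC}.

(* Inclusion of graphs, i.e. of joint actions seen as sets of pairs. *)
Definition ja_incl (A B : {set AG})
    (sA : joint_action A) (sB : joint_action B) : Prop :=
  forall (a : AG) (aA : a \in A),
    exists aB : a \in B, sB (exist _ a aB) = sA (exist _ a aA).

Definition ja_restr (A B : {set AG}) (BA : B \subset A)
    (sA : joint_action A) : joint_action B :=
  [ffun b : {b : AG | b \in B} =>
    sA (exist _ (val b) (fintype.subsetP BA (val b) (valP b)))].

End JointActions.

Definition grand (AG : finType) : {set AG} := finset.setTfor AG.

Record action_model (AG : finType) (AP : Type) := ActionModel {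
  state : Type;
  action : Type;
  state_inhabited : inhabited state;
  action_inhabited : inhabited action;
  av : forall A : {set AG}, state -> set (joint_action action A);
  out : forall A : {set AG}, state -> joint_action action A -> set state;
  lab : state -> set AP
}.

Arguments av {AG AP} M A s : rename.
Arguments out {AG AP} M A s sA : rename.
Arguments lab {AG AP} M s : rename.

Fixpoint sat (AG : finType) (AP : Type) (M : action_model AG AP) (s : state M)
    (f : formula AG AP) : Prop :=
  match f with
  | Top => True
  | Atom p => lab M s p
  | Neg g => ~ sat s g
  | And g h => sat s g /\ sat s h
  | Coal A g =>
      exists2 sA : joint_action (action M) A,
        av M A s sA & forall t : state M, out M A s sA t -> sat t g
  end.

Local Open Scope classical_set_scope.

Record general_concurrent_game (AG : finType) (AP : Type)
    (M : action_model AG AP) : Prop := GeneralConcurrentGame {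
  av_restr : forall (A : {set AG}) (s : state M),
    av M A s = ja_restr (finset.subsetT A) @` av M (grand AG) s;
  av_grand : forall s : state M,
    av M (grand AG) s = [set sg | out M (grand AG) s sg !=set0];
  out_bigcup : forall (A : {set AG}) (s : state M)
      (sA : joint_action (action M) A),
    out M A s sA =
      \bigcup_(sg in [set sg : joint_action (action M) (grand AG) |
                       ja_incl sA sg]) out M (grand AG) s sg
}.

Definition MCL_valid (AG : finType) (AP : Type) (f : formula AG AP) : Prop :=
  forall M : action_model AG AP, general_concurrent_game M ->
    forall s : state M, sat s f.

(* Main.v *)
Require Import Defs.
From mathcomp Require Import all_boot.
From mathcomp Require Import boolp classical_sets.

Set Implicit Arguments.
Unset Strict Implicit.
Unset Printing Implicit Defensive.

(** Completeness is by a canonical model. The states are the maximal consistent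
    sets. Every agent's action names a coalition [A], a formula [f] and a bit
    saying whether the agent commits to the plan [(A, f)]. At [s], a joint
    action has an outcome only if all agents name the same plan and [<A>f] is
    in [s]; the outcomes are then the states containing every [g] with
    [<{}>g] in [s] and, when all members of [A] commit, also containing [f].
    Agents naming another plan can only empty the outcome set, which is
    harmless since independence of agents is not required; so [A] can
    enforce [f] by committing. Conversely, when the agents outside [B] refuse to
    commit, a joint action of [B] enforces nothing beyond what [<A>f] with
    [A] included in [B], or [<{}>], already gives. *)

Local Open Scope classical_set_scope.

(** * Inclusion and restriction of joint actions *)

Section JointActions.
Variables (AG : finType) (AC : Type).

Lemma ja_incl_trans (A B C : {set AG}) (sA : joint_action AC A)
    (sB : joint_action AC B) (sC : joint_action AC C) :
  ja_incl sA sB -> ja_incl sB sC -> ja_incl sA sC.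
Proof.
move=> AB BC a aA; have [aB eB] := AB a aA; have [aC eC] := BC a aB.
by exists aC; rewrite eC.
Qed.

Lemma ja_restr_incl (A B : {set AG}) (BA : B \subset A)
    (sA : joint_action AC A) : ja_incl (ja_restr BA sA) sA.
Proof.
move=> a aB; exists (fintype.subsetP BA a aB); rewrite /ja_restr ffunE.
by congr (sA _); exact: val_inj.
Qed.

Lemma ja_restr_incl_restr (A B C : {set AG}) (AC' : A \subset C)
    (BC : B \subset C) (sC : joint_action AC C) :
  A \subset B -> ja_incl (ja_restr AC' sC) (ja_restr BC sC).
Proof.
move=> /fintype.subsetP AB a aA; exists (AB a aA); rewrite /ja_restr !ffunE /=.
by congr (sC _); exact: val_inj.
Qed.

Lemma ja_inclE (A B : {set AG}) (AB : A \subset B) (sA : joint_action AC A)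
    (sB : joint_action AC B) : ja_incl sA sB <-> ja_restr AB sB = sA.
Proof.
split=> [inc|<-]; last exact: ja_restr_incl.
apply/ffunP => -[a aA]; rewrite /ja_restr ffunE /=; have [aB <-] := inc a aA.
by congr (sB _); exact: val_inj.
Qed.

Lemma ja_restr_id (A : {set AG}) (AA : A \subset A) (sA : joint_action AC A) :
  ja_restr AA sA = sA.
Proof. by apply/ja_inclE => a aA; exists aA. Qed.

End JointActions.

(** * Soundness of the axioms and rules *)

Section Soundness.
Variables (AG : finType) (AP : Type).
Implicit Types (f g : formula AG AP) (A B : {set AG}).

Lemma sat_Imp (M : action_model AG AP) (s : state M) f g :
  sat s (Imp f g) <-> (sat s f -> sat s g).
Proof.
split=> /= [H Hf|H [nnf ng]]; last by apply: nnf => /H.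
by apply: contrapT => ng; apply: H; split=> // nf; apply: nf.
Qed.

(** Truth at a state is one of the valuations that [tautology] quantifies over, whence the soundness
    of tautologies. *)
Lemma prop_eval_sat (M : action_model AG AP) (s : state M) f :
  prop_eval (fun g => `[< sat s g >]) f = `[< sat s f >].
Proof.
elim: f => [|p|g IH|g IHg h IHh|A g IH] //=.
- by symmetry; apply/asboolP.
- by rewrite IH asbool_neg.
- by rewrite IHg IHh asbool_and.
Qed.

Variable M : action_model AG AP.
Hypothesis gM : general_concurrent_game M.

Lemma av_extends A (s : state M) sA : av M A s sA ->
  exists2 sg, av M (grand AG) s sg & ja_restr (finset.subsetT A) sg = sA.
Proof. by rewrite (av_restr gM) => -[sg ? ?]; exists sg. Qed.

Lemma av_ja_restr A (s : state M) sg :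
  av M (grand AG) s sg -> av M A s (ja_restr (finset.subsetT A) sg).
Proof. by move=> avg; rewrite (av_restr gM); exists sg. Qed.

(** Outcomes are collected over the grand extensions, and a larger joint action has fewer of
    them. *)
Lemma out_incl A B (s : state M) sA sB : ja_incl sA sB ->
  out M B s sB `<=` out M A s sA.
Proof.
move=> AB t; rewrite (out_bigcup gM s sB) (out_bigcup gM s sA) => -[sg Bg ot].
by exists sg => //; exact: ja_incl_trans Bg.
Qed.

Lemma out_nonempty A (s : state M) sA : av M A s sA -> out M A s sA !=set0.
Proof.
move=> /av_extends[sg avg <-].
have := avg; rewrite (av_grand gM) => -[t ot].
by exists t; apply: out_incl ot; exact: ja_restr_incl.
Qed.

Lemma MCL_sound f : MCL_derivable f -> forall s : state M, sat s f.
Proof.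
elim=> {f} [f tf|A f g|A B f AB|A|f g _ IHf _ IHg|A f g _ IHf] s.
- by apply/asboolP; rewrite -prop_eval_sat.
- apply/sat_Imp => -[s0 av0 o0]; apply/sat_Imp => -[sA avA oA].
  have inc0 : ja_incl s0 sA by move=> a a0; have := a0; rewrite finset.in_set0.
  exists sA => // t ot; have /sat_Imp := o0 t (out_incl inc0 ot); apply.
  exact: oA.
- apply/sat_Imp => -[_ /av_extends[sg avg <-] oA].
  exists (ja_restr (finset.subsetT B) sg); first exact: av_ja_restr.
  by move=> t ot; apply: oA; apply: out_incl ot; exact: ja_restr_incl_restr.
- by case=> sA /out_nonempty[t ot] /(_ t ot); apply.
- by have /sat_Imp := IHg s; apply.
- apply/sat_Imp => -[_ /av_extends[sg avg _] _].
  by exists (ja_restr (finset.subsetT _) sg); first exact: av_ja_restr.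
Qed.

End Soundness.

(** * Deduction, Lindenbaum extension and membership in maximal consistent sets *)

Section MaximalConsistentSets.
Variables (AG : finType) (AP : Type).
Implicit Types (f g h : formula AG AP) (A B : {set AG}).
Implicit Types (G s : set (formula AG AP)).

(* Derivability from hypotheses, to which only modus ponens applies. *)
Inductive entails G : formula AG AP -> Prop :=
  | entails_hyp f : G f -> entails G f
  | entails_thm f : MCL_derivable f -> entails G f
  | entails_mp f g : entails G f -> entails G (Imp f g) -> entails G g.

Lemma entails_taut G f : tautology f -> entails G f.
Proof. by move=> tf; apply/entails_thm/MCL_taut. Qed.

Lemma entails_set0 f : entails set0 f -> MCL_derivable f.
Proof. by elim=> // {}f g _ df _ dfg; exact: MCL_mp dfg. Qed.

Lemma entails_sub G G' f : G `<=` G' -> entails G f -> entails G' f.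
Proof.
move=> GG'; elim=> {f} [f Gf|f df|f g _ ef _ efg].
- exact/entails_hyp/GG'.
- exact: entails_thm.
- exact: entails_mp efg.
Qed.

Lemma deduction G f g : entails (f |` G) g -> entails G (Imp f g).
Proof.
elim=> {g} [g [->|Gg]|g dg|g h _ eg _ egh].
- by apply: entails_taut => v /=; case: prop_eval.
- apply: entails_mp (entails_hyp Gg) _.
  by apply: entails_taut => v /=; do 2!case: prop_eval.
- apply: entails_mp (entails_thm _ dg) _.
  by apply: entails_taut => v /=; do 2!case: prop_eval.
- apply: entails_mp egh _; apply: entails_mp eg _.
  by apply: entails_taut => v /=; do 3!case: prop_eval.
Qed.

Definition consistent G := ~ entails G Bot.

Lemma consistent_NegU G f : ~ entails G f -> consistent (Neg f |` G).
Proof.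
move=> nef /deduction eb; apply: nef; apply: entails_mp eb _.
by apply: entails_taut => v /=; case: prop_eval.
Qed.

(** At each modus ponens, the larger of two chain members serves both premises. The left disjunct
    covers derivations that draw nothing from [F], in particular an empty [F]. *)
Lemma entails_bigcup (F : set (set (formula AG AP))) G f :
  total_on F subset -> entails (G `|` \bigcup_(X in F) X) f ->
  entails G f \/ exists2 X, F X & entails (G `|` X) f.
Proof.
move=> totF; elim=> {f} [f [Gf|[X FX Xf]]|f df|f g _ IHf _ IHg].
- by left; exact: entails_hyp.
- by right; exists X => //; apply: entails_hyp; right.
- by left; exact: entails_thm.
- have inl X h : entails G h -> entails (G `|` X) h.
    by apply: entails_sub; exact: subsetUl.
  case: IHf => [ef|[X FX ef]]; case: IHg => [eg|[Y FY eg]].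
  + by left; exact: entails_mp eg.
  + by right; exists Y => //; apply: entails_mp eg; exact: inl.
  + by right; exists X => //; apply: entails_mp ef _; exact: inl.
  + right; have [XY|YX] := totF X Y FX FY.
      exists Y => //; apply: entails_mp eg; apply: entails_sub ef.
      exact: setUS.
    exists X => //; apply: entails_mp ef _; apply: entails_sub eg.
    exact: setUS.
Qed.

Definition mcs s := consistent s /\ forall f, s f \/ s (Neg f).

Lemma lindenbaum G : consistent G -> exists2 s, mcs s & G `<=` s.
Proof.
move=> cG.
(* Zorn is applied to the sets added to [G], not to the supersets of [G], so that the empty chain
   has an admissible union. *)
have [F FP totF|X [cX maxX]] := @Zorn_bigcup _ [set X | consistent (G `|` X)].
  by move=> /(entails_bigcup totF)[//|[X /FP]].
exists (G `|` X); last exact: subsetUl.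
split=> // f; apply: contrapT => /not_orP[nf nNf].
have inconsistent g : ~ (G `|` X) g -> entails (g |` (G `|` X)) Bot.
  move=> ng; apply: contrapT => cgX; apply: (maxX (g |` X)).
    split; first exact: subsetUr.
    by move=> gX; apply: ng; right; apply: gX; left.
  by rewrite /= setUCA.
have [eNNf eNf] := (deduction (inconsistent _ nNf), deduction (inconsistent _ nf)).
apply: cX; apply: entails_mp eNf _; apply: entails_mp eNNf _.
by apply: entails_taut => v /=; case: prop_eval.
Qed.

Section Membership.
Variable s : set (formula AG AP).
Hypothesis ms : mcs s.

Lemma mcs_entails f : entails s f -> s f.
Proof.
have [cs /(_ f)[//|sNf]] := ms; move=> ef; case: cs.
apply: entails_mp ef _; apply: entails_mp (entails_hyp sNf) _.
by apply: entails_taut => v /=; case: prop_eval.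
Qed.

Lemma mcs_Imp f g : s (Imp f g) -> s f -> s g.
Proof.
move=> /entails_hyp sfg /entails_hyp sf.
exact: mcs_entails (entails_mp sf sfg).
Qed.

Lemma mcs_derivable f : MCL_derivable f -> s f.
Proof. by move=> df; exact/mcs_entails/entails_thm. Qed.

Lemma mcs_taut f : tautology f -> s f.
Proof. by move=> tf; exact/mcs_derivable/MCL_taut. Qed.

Lemma mcs_Neg f : s (Neg f) <-> ~ s f.
Proof.
split=> [sNf sf|nsf]; last by have [_ /(_ f)[]] := ms.
case: (ms) => + _; apply; apply: entails_mp (entails_hyp sf) _.
apply: entails_mp (entails_hyp sNf) _.
by apply: entails_taut => v /=; case: prop_eval.
Qed.

Lemma mcs_And f g : s (And f g) <-> s f /\ s g.
Proof.
split=> [sfg|[sf sg]].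
  split; apply: mcs_Imp sfg; apply: mcs_taut => v /=;
  by do 2!case: prop_eval.
apply: mcs_Imp sg; apply: mcs_Imp sf; apply: mcs_taut => v /=.
by do 2!case: prop_eval.
Qed.

Lemma mcs_Coal_mono A B f : A \subset B -> s (Coal A f) -> s (Coal B f).
Proof. by move=> AB; apply/mcs_Imp/mcs_derivable/MCL_mono. Qed.

Definition box : set (formula AG AP) := [set f | s (Coal finset.set0 f)].

(* [box] contains the theorems only when some coalition has an available
   action, hence the hypothesis on [A]. *)
Lemma box_entails A f g : s (Coal A f) -> entails box g -> box g.
Proof.
move=> sAf; elim=> {g} [//|g dg|g h _ bg _ bgh].
  by apply: mcs_Imp sAf; apply/mcs_derivable/MCL_nec.
apply: mcs_Imp bg; apply: mcs_Imp bgh; apply: mcs_derivable.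
exact: MCL_K.
Qed.

(** The deduction theorem puts [Imp f g] in the box, and axiom K carries it under [Coal A]. *)
Lemma mcs_Coal_entails A f g :
  s (Coal A f) -> entails (f |` box) g -> s (Coal A g).
Proof.
move=> sAf /deduction /(box_entails sAf) bfg.
by apply: mcs_Imp sAf; apply: mcs_Imp bfg; exact/mcs_derivable/MCL_K.
Qed.

Lemma consistent_box A f : s (Coal A f) -> consistent (f |` box).
Proof.
move=> sAf /(mcs_Coal_entails sAf).
by apply/mcs_Neg/mcs_derivable/MCL_noBot.
Qed.

End Membership.

(** Otherwise [G] with [Neg f] would extend to a maximal consistent set omitting [f]. *)
Lemma mcs_entailed G f : (forall s, mcs s -> G `<=` s -> s f) -> entails G f.
Proof.
move=> H; apply: contrapT => /consistent_NegU /lindenbaum[s ms sub].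
have sNf : s (Neg f) by apply: sub; left.
by move/(mcs_Neg ms): sNf; apply; apply: H => // g Gg; apply: sub; right.
Qed.

End MaximalConsistentSets.

(** * General games generated by the outcomes of the grand coalition *)

Section GameOfOutcome.
Variables (AG : finType) (AP ST AC : Type).
Hypotheses (ST_inh : inhabited ST) (AC_inh : inhabited AC).
Variables (outg : ST -> joint_action AC (grand AG) -> set ST).
Variable lab : ST -> set AP.

(** The three conditions on general games determine [av] and [out] from [outg], and any [outg]
    whatsoever can be taken. *)
Definition game_of_outcome : action_model AG AP := {|
  state := ST;
  action := AC;
  state_inhabited := ST_inh;
  action_inhabited := AC_inh;
  av := fun A s =>
    ja_restr (finset.subsetT A) @` [set sg | outg s sg !=set0];
  out := fun A s sA => \bigcup_(sg in [set sg | ja_incl sA sg]) outg s sg;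
  Defs.lab := lab |}.

Lemma av_game_of_outcome s :
  av game_of_outcome (grand AG) s = [set sg | outg s sg !=set0].
Proof.
apply/seteqP; split=> [_ [sg osg <-]|sg osg]; first by rewrite /= ja_restr_id.
by exists sg => //; exact: ja_restr_id.
Qed.

Lemma out_game_of_outcome s sg : out game_of_outcome (grand AG) s sg = outg s sg.
Proof.
apply/seteqP; split=> [t [sg' /(ja_inclE (finset.subsetT _))]|t ot].
  by rewrite ja_restr_id => ->.
by exists sg => // a aA; exists aA.
Qed.

Lemma game_of_outcome_general : general_concurrent_game game_of_outcome.
Proof.
split=> [A s|s|A s sA]; first by rewrite av_game_of_outcome.
  rewrite av_game_of_outcome; apply: eq_set => sg.
  by rewrite out_game_of_outcome.
by apply: eq_bigcupr => sg _; rewrite out_game_of_outcome.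
Qed.

End GameOfOutcome.

(** * The canonical game and the truth lemma *)

Section CanonicalGame.
Variables (AG : finType) (AP : Type).

Notation fm := (formula AG AP).
Definition mcs_state := {s : set fm | mcs s}.
Definition plan : Type := {set AG} * fm.

Definition canonical_out (s : mcs_state)
    (sg : joint_action (plan * bool) (grand AG)) : set mcs_state :=
  [set t | exists A f, [/\ sval s (Coal A f), forall x, (sg x).1 = (A, f),
    box (sval s) `<=` sval t &
    (forall x, val x \in A -> (sg x).2) -> sval t f]].

Variable s0 : mcs_state.

Definition canonical_game : action_model AG AP :=
  game_of_outcome (inhabits s0) (inhabits ((finset.set0, Top), true))
    canonical_out (fun s p => sval s (Atom p)).

Lemma mcs_state_extends (s : mcs_state) A f : sval s (Coal A f) ->
  exists t : mcs_state, box (sval s) `<=` sval t /\ sval t f.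
Proof.
move=> /(consistent_box (svalP s))/lindenbaum[t mt sub].
by exists (exist _ t mt); split=> [g bg|]; apply: sub; [right|left].
Qed.

Lemma truth_lemma f (s : state canonical_game) : sat s f <-> sval s f.
Proof.
elim: f s => [|p|g IH|g IHg h IHh|B g IH] s.
- by split=> // _; apply: (mcs_taut (svalP s)).
- by [].
- by rewrite (mcs_Neg (svalP s)) -IH.
- by rewrite (mcs_And (svalP s)) -IHg -IHh.
- split; last first.
    (* Everyone commits to [(B, g)]. This is available since [g] is consistent with the box of
       [s]. *)
    move=> sBg; pose sg : joint_action (plan * bool) (grand AG) :=
      [ffun=> ((B, g), true)].
    exists (ja_restr (finset.subsetT B) sg).
      exists sg => //=; have [t [bt tg]] := mcs_state_extends sBg.
      by exists t, B, g; split=> // x; rewrite ffunE.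
    move=> t [sg' inc [A [f [sAf eAf bt tf]]]]; apply/IH.
    have commit x : val x \in B -> sg' x = ((B, g), true).
      case: x => a aG /= aB; have [aG'] := inc a aB.
      by rewrite /ja_restr !ffunE => <-; congr (sg' _); exact: val_inj.
    (* If [B] is empty, the outcome need not follow the plan [(B, g)], but
       then [g] is in the box of [s]. *)
    have [B0|[a aB]] := finset.set_0Vmem B.
      by apply: bt; rewrite /box /= -B0.
    have := eAf (exist _ a (finset.in_setT a)); rewrite commit //= => -[eA ef].
    by subst A f; apply: tf => x /commit ->.
(* The action of [B] is available, so it restricts some [sg] with an outcome [t0]; this yields the
   plan [(A, f)] named by [sg]. *)
move=> [_ [sg [t0 [A [f [sAf eAf _ _]]]] <-] oB].
(* The agents outside [B] keep naming the plan but refuse to commit to it. *)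
pose sg' : joint_action (plan * bool) (grand AG) :=
  [ffun x => if val x \in B then sg x else ((A, f), false)].
have sg'1 x : (sg' x).1 = (A, f) by rewrite ffunE; case: ifP.
have inc : ja_incl (ja_restr (finset.subsetT B) sg) sg'.
  move=> a aB; exists (finset.in_setT a).
  rewrite /ja_restr !ffunE /= aB.
  by congr (sg _); exact: val_inj.
have outg (t : mcs_state) : box (sval s) `<=` sval t ->
    ((forall x, val x \in A -> (sg' x).2) -> sval t f) -> sval t g.
  by move=> bt tf; apply/IH; apply: oB; exists sg' => //; exists A, f.
(* If all of [A] commits under [sg'], then [A] lies in [B], and every maximal consistent set
   containing [f] and the box is an outcome, so these entail [g]. Otherwise the box alone does. *)
have [all_commit|not_all] := pselect (forall x, val x \in A -> (sg' x).2).
  have AB : A \subset B.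
    apply/fintype.subsetP => a aA.
    have := all_commit (exist _ a (finset.in_setT a)) aA.
    by rewrite ffunE /=; case: ifP.
  apply: (mcs_Coal_mono (svalP s) AB).
  apply: (mcs_Coal_entails (svalP s) sAf); apply: mcs_entailed => t mt sub.
  apply: (outg (exist _ t mt)) => [h bh|_]; apply: sub; [by right|by left].
apply: (mcs_Coal_mono (svalP s) (finset.sub0set B)).
apply: (box_entails (svalP s) sAf); apply: mcs_entailed => t mt sub.
exact: (outg (exist _ t mt)).
Qed.

End CanonicalGame.

Lemma MCL_complete (AG : finType) (AP : Type) (f : formula AG AP) :
  MCL_valid f -> MCL_derivable f.
Proof.
move=> vf; apply: entails_set0; apply: mcs_entailed => s ms _.
(* The set [s] is both the state of evaluation and the witness that the canonical game has a
   state. *)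
pose s0 : mcs_state AG AP := exist _ s ms.
apply/(truth_lemma (s0 := s0) f s0); apply: vf.
exact: game_of_outcome_general.
Qed.

Theorem mainTheorem1 (AG : finType) (AG_nonempty : 0 < #|AG|)
    (AP : countType) (f : formula AG AP) :
  MCL_derivable f <-> MCL_valid f.
Proof.
split; last exact: MCL_complete.
by move=> df M gM s; exact: MCL_sound.
Qed.
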